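(* Let $X\subset\mathbb{R}^s$ be an open set, let $C\subset\mathbb{R}^n$ and $K\subset\mathbb{R}^m$ be closed convex cones with vertex at the origin, and let $f:X\to\mathbb{R}^n$ and $g:X\to\mathbb{R}^m$ be Fréchet differentiable functions. Consider the problem (P): $C$-minimize $f(x)$ subject to $g(x)\in-K$. Suppose that (P) is FJ-pseudoconvex and that $x$ is a Fritz John stationary point of (P). Then $x$ is a weakly efficient global solution of (P).
   Context: Notation: $a\cdot b$ is the scalar product in Euclidean space, $Jf(x)$ and $Jg(x)$ are Jacobian matrices, $\lambda\cdot Jf(x)=\lambda^{T}Jf(x)$, $\mathrm{int}$ is topological interior. For a cone $A$ in a Euclidean space, the positive polar cone is $A^*=\{\lambda\mid\lambda\cdot a\ge0\text{ for all }a\in A\}$, and $A^{**}=(A^* )^*$. A point $x\in X$ is feasible for (P) iff $g(x)\in -K$. For a feasible point $x$ put $M^*(x)=\{\mu\in K^*\mid\mu\cdot g(x)=0\}$, and let $M^{**}(x)$ be the positive polar cone of $M^*(x)$. A feasible point $x$ is a weakly efficient global solution (weak global minimizer) of (P) iff there is no other feasible point $y$ such that $f(y)\in f(x)-\mathrm{int}(C)$. A feasible point $x$ is a Fritz John stationary (critical) point of (P) iff there exist $\lambda\in C^*$ and $\mu\in K^*$ with $(\lambda,\mu)\neq(0,0)$, $\lambda\cdot Jf(x)+\mu\cdot Jg(x)=0$ and $\mu\cdot g(x)=0$. Problem (P) is called FJ-pseudoconvex (Fritz John pseudoconvex) iff for all $x,y\in X$ the following implication holds: if $f(y)\in f(x)-\mathrm{int}(C)$,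 $g(x)\in-K$ and $g(y)\in-K$, then $Jf(x)(y-x)\in-\mathrm{int}(C^{**})$ and $Jg(x)(y-x)\in-\mathrm{int}(M^{**}(x))$. *)

(* Defs.v *)
From HB Require Import structures.
From mathcomp Require Import all_boot all_order all_algebra.
From mathcomp Require Import all_classical all_reals all_analysis.

Set Implicit Arguments.
Unset Strict Implicit.
Unset Printing Implicit Defensive.
Import Order.TTheory GRing.Theory Num.Theory.
Import numFieldNormedType.Exports.
Local Open Scope classical_set_scope.
Local Open Scope ring_scope.

(* Points of R^d are row vectors 'rV[R]_d. The matrices carry the sup norm in
   the library; differentiability, interior and closedness agree with those of
   the Euclidean norm. *)

Section Cones.
Context {R : realType} {d : nat}.
Implicit Types A : set 'rV[R]_d.

Definition dot (u v : 'rV[R]_d) : R := \sum_(i < d) u ord0 i * v ord0 i.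

(* Cone with vertex at the origin. For closed sets, the variant that only
   scales by t > 0 is the same notion. *)
Definition cone A : Prop :=
  A !=set0 /\ forall (t : R) a, 0 <= t -> A a -> A (t *: a).

Definition closed_convex_cone A : Prop :=
  [/\ closed A, convex_set (A : set (convex_lmodType 'rV[R]_d)) & cone A].

Definition polar A : set 'rV[R]_d :=
  [set l | forall a, A a -> 0 <= dot l a].

Definition opp_set A : set 'rV[R]_d := [set - a | a in A].

End Cones.

(* The data (X, f, g, C, K) of the problem "C-minimize f(x) subject to
   g(x) \in -K, x \in X". The functions are total, but only their values on X
   matter: X is open in the intended use, so differentiability and the Jacobian
   at a point of X do not depend on the values outside X. *)
Section Problem.
Context {R : realType} {s n m : nat}.
Variables (X : set 'rV[R]_s) (f : 'rV[R]_s -> 'rV[R]_n)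
  (g : 'rV[R]_s -> 'rV[R]_m) (C : set 'rV[R]_n) (K : set 'rV[R]_m).

Definition feasible (x : 'rV[R]_s) : Prop := X x /\ opp_set K (g x).

Definition strictly_better (y x : 'rV[R]_s) : Prop :=
  [set f x - c | c in interior C] (f y).

Definition active_multipliers (x : 'rV[R]_s) : set 'rV[R]_m :=
  [set mu | polar K mu /\ dot mu (g x) = 0].

Definition weakly_efficient (x : 'rV[R]_s) : Prop :=
  feasible x /\
  ~ exists y, [/\ y <> x, feasible y & strictly_better y x].

(* The library Jacobian acts on row vectors, v *m 'J f x = 'd f x v, so it is
   the transpose of the usual n x s Jacobian matrix. *)
Definition FJ_stationary (x : 'rV[R]_s) : Prop :=
  feasible x /\
  exists (lambda : 'rV[R]_n) (mu : 'rV[R]_m),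
    [/\ polar C lambda, polar K mu, (lambda, mu) <> (0, 0),
        lambda *m ('J f x)^T + mu *m ('J g x)^T = 0 & dot mu (g x) = 0].

Definition FJ_pseudoconvex : Prop :=
  forall x y, X x -> X y ->
    strictly_better y x -> opp_set K (g x) -> opp_set K (g y) ->
    opp_set (interior (polar (polar C))) ((y - x) *m 'J f x) /\
    opp_set (interior (polar (active_multipliers x))) ((y - x) *m 'J g x).

End Problem.

(* Main.v *)
Require Import Defs.
From HB Require Import structures.
From mathcomp Require Import all_boot all_order all_algebra.
From mathcomp Require Import all_classical all_reals all_analysis.
Import Order.TTheory GRing.Theory Num.Theory.
Import numFieldNormedType.Exports.
Local Open Scope classical_set_scope.
Local Open Scope ring_scope.

(** Suppose that a feasible [y] were strictly better than the stationary point
    [x], with multipliers [lambda] and [mu], and put [v := y - x].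
    Pseudoconvexity places [- Jf(x) v] in the interior of the polar of [C^*],
    a cone containing [lambda], and [- Jg(x) v] in the interior of the polar
    of [M^*(x)], a cone containing [mu]. An interior point of a polar cone
    pairs strictly positively with every nonzero element of the original set
    ([dot_interior_polar_gt0]). Since [lambda] and [mu] are not both zero,
    [(lambda Jf(x) + mu Jg(x)) . v < 0], whereas stationarity makes this
    number zero. *)

Lemma dotE {R : realType} {d : nat} (u v : 'rV[R]_d) :
  dot u v = (u *m v^T) ord0 ord0.
Proof. by rewrite mxE; apply: eq_bigr => i _; rewrite mxE. Qed.

Lemma dotC {R : realType} {d : nat} (u v : 'rV[R]_d) : dot u v = dot v u.
Proof. by apply: eq_bigr => i _; rewrite mulrC. Qed.

Lemma dot0l {R : realType} {d : nat} (v : 'rV[R]_d) : dot 0 v = 0.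
Proof. by rewrite dotE mul0mx mxE. Qed.

Lemma dotDl {R : realType} {d : nat} (u v w : 'rV[R]_d) :
  dot (u + v) w = dot u w + dot v w.
Proof. by rewrite !dotE mulmxDl mxE. Qed.

Lemma dotZl {R : realType} {d : nat} (t : R) (u v : 'rV[R]_d) :
  dot (t *: u) v = t * dot u v.
Proof. by rewrite !dotE -scalemxAl mxE. Qed.

Lemma dotNr {R : realType} {d : nat} (u v : 'rV[R]_d) :
  dot u (- v) = - dot u v.
Proof. by rewrite dotC -scaleN1r dotZl mulN1r dotC. Qed.

Lemma dot_mulmxr {R : realType} {p q : nat} (u : 'rV[R]_q) (v : 'rV[R]_p)
    (A : 'M[R]_(p, q)) :
  dot u (v *m A) = dot (u *m A^T) v.
Proof. by rewrite !dotE trmx_mul mulmxA. Qed.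

Lemma dot_self_gt0 {R : realType} {d : nat} (u : 'rV[R]_d) :
  u != 0 -> 0 < dot u u.
Proof.
move=> u0; have sq_ge0 i : 0 <= u ord0 i * u ord0 i by rewrite -expr2 sqr_ge0.
rewrite lt_def sumr_ge0 // andbT; apply: contra u0 => /eqP uu0.
apply/eqP/rowP => i; rewrite mxE; apply/eqP.
by rewrite -sqrf_eq0 expr2 (psumr_eq0P _ uu0).
Qed.

(** An interior point [p] can be moved slightly in the direction [- a] without
    leaving the polar cone; as this lowers the pairing with [a] by a positive
    multiple of [a . a], the pairing was positive to begin with. *)
Lemma dot_interior_polar_gt0 {R : realType} {d : nat} {A : set 'rV[R]_d}
    {p a : 'rV[R]_d} :
  interior (polar A) p -> A a -> a != 0 -> 0 < dot a p.
Proof.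
move=> pA Aa a0.
have shift_cvg : (p - t *: a) @[t --> (0 : R)^'+] --> p.
  rewrite -[X in _ --> X]subr0 -[X in _ - X](scale0r a).
  apply: cvg_within_filter.
  apply: cvgB; first exact: cvg_cst.
  by apply: cvgZr_tmp; exact: cvg_id.
have [t [t0 /(_ a Aa)]] : exists t, 0 < t /\ polar A (p - t *: a).
  have : \forall t \near (0 : R)^'+, 0 < t /\ polar A (p - t *: a).
    by apply: filterI; [exact: nbhs_right_gt | exact: (shift_cvg _ pA)].
  by move=> /filter_ex.
rewrite -scaleNr dotDl dotZl mulNr subr_ge0 dotC; apply: lt_le_trans.
by rewrite mulr_gt0 // dot_self_gt0.
Qed.

(** The sign-reversed form in which pseudoconvexity is used; the weak
    inequality also covers a zero multiplier. *)
Lemma dot_opp_interior_polar {R : realType} {d : nat} {A : set 'rV[R]_d}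
    {w a : 'rV[R]_d} :
  opp_set (interior (polar A)) w -> A a ->
  dot a w <= 0 /\ (a != 0 -> dot a w < 0).
Proof.
move=> [p pA <-] Aa; rewrite dotNr oppr_le0 oppr_lt0.
split; last exact: dot_interior_polar_gt0 pA Aa.
by rewrite dotC; exact: (interior_subset pA).
Qed.

Theorem theorem2 (R : realType) (s n m : nat) (X : set 'rV[R]_s)
    (f : 'rV[R]_s -> 'rV[R]_n) (g : 'rV[R]_s -> 'rV[R]_m)
    (C : set 'rV[R]_n) (K : set 'rV[R]_m) (x : 'rV[R]_s)
    (openX : open X)
    (coneC : closed_convex_cone C) (coneK : closed_convex_cone K)
    (df : forall z, X z -> differentiable f z)
    (dg : forall z, X z -> differentiable g z)
    (pcvx : FJ_pseudoconvex X f g C K)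
    (FJx : FJ_stationary X f g C K x) :
  weakly_efficient X f g C K x.
Proof.
case: FJx => -[Xx Kgx] [lambda [mu [Clambda Kmu nz stat mug]]].
split=> // -[y [_ [Xy Kgy] better]].
have [Jfv Jgv] := pcvx _ _ Xx Xy better Kgx Kgy.
have [lambda_le lambda_lt] := dot_opp_interior_polar Jfv Clambda.
have [mu_le mu_lt] := dot_opp_interior_polar Jgv (conj Kmu mug).
have : dot lambda ((y - x) *m 'J f x) + dot mu ((y - x) *m 'J g x) = 0.
  by rewrite !dot_mulmxr -dotDl stat dot0l.
apply/eqP; rewrite lt_eqF //.
have [lambda0|/lambda_lt lt0] := eqVneq lambda 0; last exact: ltr_wnDr.
have [mu0|/mu_lt lt0] := eqVneq mu 0; last exact: ltr_wnDl.
by case: nz; rewrite lambda0 mu0.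
Qed.
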